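(* Let $n,n_y,q\ge 1$ be integers, let $k$ be a time index, and let $P^d_{kq}\in\mathbb{R}^{n\times n}$ be a prescribed symmetric positive definite matrix. Let the posterior ensemble at time $k-1$, $\mathcal{X}^{+}_{k-1}$, be given, let $\mathcal{X}_k^-$ be the prior ensemble at time $k$ obtained from it by propagating its members through the augmented dynamics, and let $\Sigma^-_{xx,k}\in\mathbb{R}^{nq\times nq}$, $\Sigma^-_{xy,k}\in\mathbb{R}^{nq\times qn_y}$, $\Sigma^-_{yy,k}\in\mathbb{R}^{qn_y\times qn_y}$ be the prior covariance matrices computed from $\mathcal{X}_k^-$ by either the Ensemble Kalman filter (EnKF) formulas or the Unscented Kalman filter (UKF) formulas (both given in the context). Assume $\Sigma^-_{yy,k}\succ 0$. Let $M_q:=[0_{n\times n},\dots,0_{n\times n},I_{n\times n}]\in\mathbb{R}^{n\times nq}$ ($q-1$ zero blocks). For $\lambda=[\lambda_1,\dots,\lambda_{qn_y}]^T$ with all $\lambda_i\ge 0$, let $\Sigma^+_{xx,k}(\lambda)$ be the posterior covariance corresponding to sensor precisions $\lambda$ (defined in the context). Then the optimal sensor precisions guaranteeing the bound $M_q\Sigma^+_{xx,k}M_q^T\preceq P^d_{kq}$, i.e. the minimizers of $\|\lambda\|_1$ over all $\lambda\in\mathbb{R}^{qn_y}$ with $\lambda_i\ge 0$ for all $i$ and $$M_q\,\Sigma^+_{xx,k}(\lambda)\,M_q^T\preceq P^d_{kq},$$ are exactly the solutions of the following problem, which is a semidefinite program (its matrix constraint is a linear matrix inequality, i.e. affine in $\lambda$):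 $$\lambda_k^*\in\arg\min_{\lambda=[\lambda_1,\dots,\lambda_{qn_y}]^T}\|\lambda\|_1$$ subject to $$\begin{bmatrix}P^d_{kq}+A & B\\ B^T & D\end{bmatrix}\succeq 0,\qquad \lambda_i\ge 0\ \text{ for all } i\in\{1,\dots,qn_y\},$$ where $$A:=-M_q\Sigma^-_{xx,k}M_q^T+M_q\Sigma^-_{xy,k}\,\mathcal{S}\,(\Sigma^-_{xy,k})^TM_q^T,\qquad B:=M_q\Sigma^-_{xy,k}\,\mathcal{S},$$ $$D:=(\Sigma^-_{yy,k})^{-1}+\mathcal{S},\qquad \mathcal{S}:=\mathrm{diag}([\lambda_1,\dots,\lambda_{qn_y}]).$$
   Context: Notation. $M\succ0$ (resp. $\succeq 0$) means symmetric positive definite (resp. semidefinite); $M\preceq N$ means $N-M\succeq0$. $\mathbf{1}_m$ is the column vector of $m$ ones. System. The underlying discrete-time system is $x_{j+1}=f_j(x_j,w_j)$, $y_j=h_j(x_j)+v_j$ with $x_j\in\mathbb{R}^n$, $y_j\in\mathbb{R}^{n_y}$, $w_j\in\mathbb{R}^{n_w}$, where $w_j\sim\mathcal N(0,Q_j)$ and $v_j\sim\mathcal N(0,R_j)$ are independent zero-mean Gaussian white noises, independent of the Gaussian initial state, and $R_j$ is diagonal. Augmented model. Batches of $q$ time steps are stacked: $X_k:=[x_{kq-q+1}^T,\dots,x_{kq}^T]^T$, $Y_k:=[y_{kq-q+1}^T,\dots,y_{kq}^T]^T$, $W_k:=[w_{kq-q+1}^T,\dots,w_{kq+q-1}^T]^T\sim\mathcal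 N(0,\mathcal Q_k)$ with $\mathcal Q_k=\mathrm{diag}(Q_{kq-q+1},\dots,Q_{kq+q-1})$, and $V_k:=[v_{kq-q+1}^T,\dots,v_{kq}^T]^T\sim\mathcal N(0,\mathcal R_k)$ with $\mathcal R_k=\mathrm{diag}(R_{kq-q+1},\dots,R_{kq})$. They satisfy $X_{k+1}=F_k(X_k,W_k)$ and $Y_k=H_k(X_k)+V_k$, where $F_k$ is generated recursively from the maps $f_j$ and $H_k$ stacks the maps $h_j$. Applied to a matrix, $H_k$ acts column by column. Precisions and posterior covariance. The precision matrix is $\mathcal S_k:=\mathcal R_k^{-1}=\mathrm{diag}([\lambda_1,\dots,\lambda_{qn_y}])$; $\lambda_i$ is the precision of the $i$-th sensor. For $\lambda_i>0$ for all $i$, both filters use the covariance update $$\Sigma^+_{xx,k}(\lambda)=\Sigma^-_{xx,k}-\Sigma^-_{xy,k}\big(\Sigma^-_{yy,k}+\mathrm{diag}([\lambda_1,\dots,\lambda_{qn_y}])^{-1}\big)^{-1}(\Sigma^-_{xy,k})^T.$$ If some $\lambda_i=0$, those sensors are considered removed: with $I=\{i:\lambda_i>0\}$, $\Sigma^+_{xx,k}(\lambda)$ is given by the same formula with $\Sigma^-_{xy,k}$ replaced by its columns indexed by $I$, and $\Sigma^-_{yy,k}$ and the diagonal matrix replaced by their submatrices with rows and columns indexed by $I$ (and $\Sigma^+_{xx,k}(\lambda)=\Sigma^-_{xx,k}$ if $I=\emptyset$). EnKF prior matrices. $\mathcal X_{k-1}^+=[X^{1+}_{k-1},\dots,X^{N+}_{k-1}]$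 has $N\ge 2$ members; $X_k^{i-}=F_{k-1}(X_{k-1}^{i+},W_{k-1}^i)$ with $W_{k-1}^i$ sampled from $\mathcal N(0,\mathcal Q_{k-1})$; $\mathcal X_k^-=[X_k^{1-},\dots,X_k^{N-}]$; $\bar{\mathcal X}_k^-=\frac1N\mathcal X_k^-\mathbf 1_N\mathbf 1_N^T$. Then $\Sigma^-_{xx,k}=\frac1{N-1}\mathcal X_k^-\big(I_N-\tfrac{\mathbf 1_N\mathbf 1_N^T}{N}\big)\big(I_N-\tfrac{\mathbf 1_N\mathbf 1_N^T}{N}\big)(\mathcal X_k^-)^T$, $\Sigma^-_{xy,k}=\frac1{N-1}(\mathcal X_k^--\bar{\mathcal X}_k^-)(H_k(\mathcal X_k^-)-H_k(\bar{\mathcal X}_k^-))^T$, $\Sigma^-_{yy,k}=\frac1{N-1}(H_k(\mathcal X_k^-)-H_k(\bar{\mathcal X}_k^-))(H_k(\mathcal X_k^-)-H_k(\bar{\mathcal X}_k^-))^T$. UKF prior matrices. Let $n_a$ be the dimension of the vector obtained by stacking $X_{k-1}$ and $W_{k-1}$, with mean ${}_a\mu$ and covariance ${}_a\Sigma=\mathrm{diag}(\Sigma^+_{xx,k-1},\mathcal Q_{k-1})$. The members of the ensemble, stacked as $(X_{k-1}^{i+},W_{k-1}^i)$, are the $N=2n_a+1$ sigma points ${}_a\mu$, ${}_a\mu+(\sqrt{(n_a+\rho)\,{}_a\Sigma})_i$ for $i=1,\dots,n_a$, and ${}_a\mu-(\sqrt{(n_a+\rho)\,{}_a\Sigma})_{i-n_a}$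 for $i=n_a+1,\dots,2n_a$, where $(\cdot)_i$ is the $i$-th row of the matrix square root and $\rho=\alpha^2(n_a+\kappa)-n_a$ with $\alpha=0.001$, $\kappa=0$, $\beta=2$. The weights are $\omega_0^{(m)}=\rho/(n_a+\rho)$, $\omega_0^{(c)}=\rho/(n_a+\rho)+(1-\alpha^2+\beta)$, $\omega_i^{(m)}=\omega_i^{(c)}=1/\{2(n_a+\rho)\}$ for $i\ge1$, collected in column vectors $\mathcal W^m,\mathcal W^c\in\mathbb{R}^N$. Set $X_k^{i-}=F_{k-1}(X_{k-1}^{i+},W_{k-1}^i)$, let $\mathcal X_k^-$ be the matrix with these columns, $\mathcal Y_k^-=H_k(\mathcal X_k^-)$, $\bar{\mathcal X}_k^-=\mathcal X_k^-\mathcal W^m\mathbf 1_N^T$, $\bar{\mathcal Y}_k^-=\mathcal Y_k^-\mathcal W^m\mathbf 1_N^T$. Then $\Sigma^-_{xx,k}=\mathcal X_k^-LL^T(\mathcal X_k^-)^T$ with $L=\mathrm{diag}(\mathcal W^c)-\mathcal W^c\mathbf 1_N^T$, $\Sigma^-_{xy,k}=(\mathcal X_k^--\bar{\mathcal X}_k^-)\,\mathrm{diag}(\mathcal W^c)\,(\mathcal Y_k^--\bar{\mathcal Y}_k^-)^T$, $\Sigma^-_{yy,k}=(\mathcal Y_k^--\bar{\mathcal Y}_k^-)\,\mathrm{diag}(\mathcal W^c)\,(\mathcal Y_k^--\bar{\mathcal Y}_k^-)^T$. *)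

(* Defs.v *)
From HB Require Import structures.
From mathcomp Require Export all_boot all_order all_algebra.
From mathcomp Require Export reals.

Set Implicit Arguments.
Unset Strict Implicit.
Unset Printing Implicit Defensive.

Import Order.TTheory GRing.Theory Num.Theory.
Local Open Scope ring_scope.

(* Dimension of a stack of [q] blocks of size [n], in the form used by
   [\mxcol], [\mxrow] and [\mxdiag]; it equals [q * n]. *)
Notation stacked q n := (\sum_(i < q) n)%N.

Section Matrices.
Context {R : realType}.

Definition posdef m (M : 'M[R]_m) : Prop :=
  M^T = M /\ forall x : 'cV[R]_m, x != 0 -> 0 < (x^T *m M *m x) 0 0.

Definition possemidef m (M : 'M[R]_m) : Prop :=
  M^T = M /\ forall x : 'cV[R]_m, 0 <= (x^T *m M *m x) 0 0.

Definition loewner_le m (M N : 'M[R]_m) : Prop := possemidef (N - M).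

Definition ones m : 'cV[R]_m := const_mx 1.

Definition norm1 m (l : 'cV[R]_m) : R := \sum_i `|l i 0|.

Definition minimizer T (C : T -> Prop) (J : T -> R) (x : T) : Prop :=
  C x /\ forall y, C y -> J x <= J y.

(* [Psi l >= 0] is a linear matrix inequality in [l]. *)
Definition affine_symmetric m p (Psi : 'cV[R]_m -> 'M[R]_p) : Prop :=
  exists (G0 : 'M[R]_p) (G : 'I_m -> 'M[R]_p),
    [/\ G0^T = G0,
        forall i, (G i)^T = G i
      & forall l : 'cV[R]_m, Psi l = G0 + \sum_i l i 0 *: G i].

(* Minimizing [J l] subject to [l >= 0] and [Psi l >= 0] is a semidefinite
   program: the cost is linear on the nonnegative orthant and the matrix
   constraint is a linear matrix inequality. *)
Definition semidefinite_program m p (J : 'cV[R]_m -> R)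
    (Psi : 'cV[R]_m -> 'M[R]_p) : Prop :=
  (exists c : 'cV[R]_m,
     forall l : 'cV[R]_m, (forall i, 0 <= l i 0) -> J l = (c^T *m l) 0 0)
  /\ affine_symmetric Psi.

(* Apply a map of column vectors to a matrix, column by column. *)
Definition colwise m p N (g : 'cV[R]_m -> 'cV[R]_p) (X : 'M[R]_(m, N)) :
    'M[R]_(p, N) :=
  \matrix_(a, i) g (col i X) a 0.

End Matrices.

Section AugmentedModel.
Context {R : realType}.
Variables (n ny nw q : nat).
Variables (f : int -> 'cV[R]_n -> 'cV[R]_nw -> 'cV[R]_n).
Variables (h : int -> 'cV[R]_n -> 'cV[R]_ny).
Variables (Q : int -> 'M[R]_nw).

(* Time is integer-valued, so that no index below is truncated at 0. The
   block number [i], counted from 0, of batch [k] lives at time kq - q + 1 + i. *)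
Definition batch_time (k : int) (i : nat) : int :=
  k * q%:Z - q%:Z + 1 + i%:Z.

(* State reached from [x] at time [j] after [s] steps driven by the noises
   [w 0, w 1, ...], i.e. those of times j, j + 1, ... *)
Fixpoint flow (j : int) (w : nat -> 'cV[R]_nw) (s : nat) (x : 'cV[R]_n) :
    'cV[R]_n :=
  if s is s'.+1 then f (j + s'%:Z) (flow j w s' x) (w s') else x.

(* Only indices [l < 2q - 1] are ever used: the default 0 is never reached. *)
Definition noise_block (W : 'cV[R]_(stacked (q.*2.-1) nw)) (l : nat) :
    'cV[R]_nw :=
  if insub l is Some l' then submxcol W l' else 0.

(* The map F_k. Each of the [q] blocks of X_k is advanced by [q] time steps:
   block [i] consumes the noise blocks i, ..., i + q - 1, and together the
   blocks consume exactly w_{kq-q+1}, ..., w_{kq+q-1}, i.e. all of W_k. *)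
Definition augF (k : int) (X : 'cV[R]_(stacked q n))
    (W : 'cV[R]_(stacked (q.*2.-1) nw)) : 'cV[R]_(stacked q n) :=
  \mxcol_(i < q)
    flow (batch_time k i) (fun s => noise_block W (i + s)) q (submxcol X i).

Definition augH (k : int) (X : 'cV[R]_(stacked q n)) : 'cV[R]_(stacked q ny) :=
  \mxcol_(i < q) h (batch_time k i) (submxcol X i).

Definition augQ (k : int) : 'M[R]_(stacked (q.*2.-1) nw) :=
  \mxdiag_(l < q.*2.-1) Q (batch_time k l).

Lemma augF_trajectory (x : int -> 'cV[R]_n) (w : int -> 'cV[R]_nw) (k : int) :
  (forall j, x (j + 1) = f j (x j) (w j)) ->
  augF k (\mxcol_(i < q) x (batch_time k i))
         (\mxcol_(l < q.*2.-1) w (batch_time k l))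
  = \mxcol_(i < q) x (batch_time (k + 1) i).
Proof.
move=> xE; apply: eq_mxcol => i; rewrite mxcolK.
have -> : batch_time (k + 1) i = batch_time k i + q%:Z.
  by rewrite /batch_time mulrDl mul1r addrK [RHS]addrC !addrA (addrC q%:Z) addrK.
suff H s : (s <= q)%N ->
    flow (batch_time k i)
      (fun s0 => noise_block (\mxcol_(l < q.*2.-1) w (batch_time k l)) (i + s0))
      s (x (batch_time k i)) = x (batch_time k i + s%:Z) by exact: H.
elim: s => [|s IH] sq /=; first by rewrite addr0.
rewrite IH ?(ltnW sq)// intS (addrC 1) addrA xE; congr (f _ _ _).
have lq : (i + s < q.*2.-1)%N.
  have q0 : (0 < q)%N by exact: leq_ltn_trans sq.
  rewrite -ltnS prednK ?double_gt0// -addnn -addSn -addnS.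
  by rewrite leq_add.
rewrite /noise_block (insubT (fun l => (l < q.*2.-1)%N) lq) mxcolK /=.
by rewrite /batch_time PoszD !addrA.
Qed.

(* M_q = [0, ..., 0, I]: selects the last block. *)
Definition last_block : 'M[R]_(n, stacked q n) :=
  \mxrow_(i < q) (if i.+1 == q then 1%:M else 0 : 'M[R]_n).

(* Members of the prior ensemble, from posterior members and noise samples. *)
Definition propagate (k : int) N (Xp : 'M[R]_(stacked q n, N))
    (Wp : 'M[R]_(stacked (q.*2.-1) nw, N)) : 'M[R]_(stacked q n, N) :=
  \matrix_(a, i) augF (k - 1) (col i Xp) (col i Wp) a 0.

End AugmentedModel.

(* In both filters [X] is the prior ensemble and [H] the augmented output map. *)

Section EnKF.
Context {R : realType}.
Variables (m p N : nat) (H : 'cV[R]_m -> 'cV[R]_p) (X : 'M[R]_(m, N)).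

Let o : 'cV[R]_N := ones N.
Let centering : 'M[R]_N := 1%:M - N%:R^-1 *: (o *m o^T).
Let Xbar : 'M[R]_(m, N) := N%:R^-1 *: (X *m o *m o^T).
Let dY : 'M[R]_(p, N) := colwise H X - colwise H Xbar.

Definition enkf_xx : 'M[R]_m :=
  (N%:R - 1)^-1 *: (X *m centering *m centering *m X^T).
Definition enkf_xy : 'M[R]_(m, p) := (N%:R - 1)^-1 *: ((X - Xbar) *m dY^T).
Definition enkf_yy : 'M[R]_p := (N%:R - 1)^-1 *: (dY *m dY^T).

End EnKF.

Section UKF.
Context {R : realType}.

Definition ukf_alpha : R := 1 / 1000%:R.
Definition ukf_kappa : R := 0.
Definition ukf_beta : R := 2%:R.

Variable na : nat.

Definition ukf_rho : R := ukf_alpha ^+ 2 * (na%:R + ukf_kappa) - na%:R.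

Let w0 : R := ukf_rho / (na%:R + ukf_rho).
Let wi : R := 1 / (2%:R * (na%:R + ukf_rho)).

Definition ukf_wm : 'cV[R]_(1 + (na + na)) := col_mx w0%:M (const_mx wi).
Definition ukf_wc : 'cV[R]_(1 + (na + na)) :=
  col_mx (w0 + (1 - ukf_alpha ^+ 2 + ukf_beta))%:M (const_mx wi).

(* A square root of [A] whose rows are to be used as the deviations of the
   sigma points: the sum of the outer products of its rows is [A]. Both the
   symmetric root and the upper triangular Cholesky factor qualify. *)
Definition row_square_root (S A : 'M[R]_na) : Prop := S^T *m S = A.

(* Columns: mu, then mu + (row i of S)^T, then mu - (row i of S)^T. *)
Definition sigma_points (mu : 'cV[R]_na) (S : 'M[R]_na) :
    'M[R]_(na, 1 + (na + na)) :=
  row_mx mu (row_mx (mu *m (ones na)^T + S^T) (mu *m (ones na)^T - S^T)).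

Variables (m p : nat) (H : 'cV[R]_m -> 'cV[R]_p).
Variable X : 'M[R]_(m, 1 + (na + na)).

Let o : 'cV[R]_(1 + (na + na)) := ones _.
Let L : 'M[R]_(1 + (na + na)) := diag_mx ukf_wc^T - ukf_wc *m o^T.
Let Y : 'M[R]_(p, 1 + (na + na)) := colwise H X.
Let dX : 'M[R]_(m, 1 + (na + na)) := X - X *m ukf_wm *m o^T.
Let dY : 'M[R]_(p, 1 + (na + na)) := Y - Y *m ukf_wm *m o^T.

Definition ukf_xx : 'M[R]_m := X *m L *m L^T *m X^T.
Definition ukf_xy : 'M[R]_(m, p) := dX *m diag_mx ukf_wc^T *m dY^T.
Definition ukf_yy : 'M[R]_p := dY *m diag_mx ukf_wc^T *m dY^T.

End UKF.

Section Priors.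
Context {R : realType}.
Variables (n ny nw q : nat).
Variables (f : int -> 'cV[R]_n -> 'cV[R]_nw -> 'cV[R]_n).
Variables (h : int -> 'cV[R]_n -> 'cV[R]_ny).
Variables (Q : int -> 'M[R]_nw) (k : int).
Variables (Sxx : 'M[R]_(stacked q n)) (Sxy : 'M[R]_(stacked q n, stacked q ny)).
Variable Syy : 'M[R]_(stacked q ny).

(* [Xp] is the posterior ensemble at time k - 1 and [Wp] an arbitrary
   realization of the noise samples. *)
Definition enkf_prior : Prop :=
  exists (N : nat) (Xp : 'M[R]_(stacked q n, N))
         (Wp : 'M[R]_(stacked (q.*2.-1) nw, N)),
    let X := propagate f k Xp Wp in
    [/\ (2 <= N)%N, Sxx = enkf_xx X,
        Sxy = enkf_xy (augH h k) X & Syy = enkf_yy (augH h k) X].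

(* [mu] and [Sp] are the posterior mean and covariance at time k - 1; the
   noise part of the stacked vector has mean 0. *)
Definition ukf_prior : Prop :=
  exists (mu : 'cV[R]_(stacked q n)) (Sp : 'M[R]_(stacked q n))
         (S : 'M[R]_(stacked q n + stacked (q.*2.-1) nw)),
    let na := (stacked q n + stacked (q.*2.-1) nw)%N in
    let amu : 'cV[R]_na := col_mx mu 0 in
    let aSigma : 'M[R]_na := block_mx Sp 0 0 (augQ q Q (k - 1)) in
    let points := sigma_points amu S in
    let X := propagate f k (usubmx points) (dsubmx points) in
    [/\ possemidef Sp,
        row_square_root S ((na%:R + ukf_rho na) *: aSigma),
        Sxx = ukf_xx X,
        Sxy = ukf_xy (augH h k) X
      & Syy = ukf_yy (augH h k) X].

End Priors.

Section SensorPrecisions.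
Context {R : realType}.
Variables (m p : nat).
Variables (Sxx : 'M[R]_m) (Sxy : 'M[R]_(m, p)) (Syy : 'M[R]_p).

(* Only the sensors of positive precision, enumerated by [e], are kept. When
   all precisions are positive this is the formula with all sensors; when none
   is, the products are over an empty index type and the value is [Sxx]. *)
Definition posterior (l : 'cV[R]_p) : 'M[R]_m :=
  let I := [set i | 0 < l i 0] in
  let e (a : 'I_#|I|) : 'I_p := enum_val a in
  let Sxy' := colsub e Sxy in
  let Syy' := mxsub e e Syy in
  let l' := rowsub e l in
  Sxx - Sxy' *m invmx (Syy' + invmx (diag_mx l'^T)) *m Sxy'^T.

Definition bound_feasible n (M : 'M[R]_(n, m)) (P : 'M[R]_n) (l : 'cV[R]_p) :
    Prop :=
  (forall i, 0 <= l i 0) /\ loewner_le (M *m posterior l *m M^T) P.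

Definition lmi_matrix n (M : 'M[R]_(n, m)) (P : 'M[R]_n) (l : 'cV[R]_p) :
    'M[R]_(n + p) :=
  let S := diag_mx l^T in
  let A := - (M *m Sxx *m M^T) + M *m Sxy *m S *m Sxy^T *m M^T in
  let B := M *m Sxy *m S in
  let D := invmx Syy + S in
  block_mx (P + A) B B^T D.

Definition lmi_feasible n (M : 'M[R]_(n, m)) (P : 'M[R]_n) (l : 'cV[R]_p) :
    Prop :=
  possemidef (lmi_matrix M P l) /\ forall i, 0 <= l i 0.

End SensorPrecisions.

(* Main.v *)
(* Write S = E T E^T, where T is the positive diagonal matrix of the nonzero
   precisions and E selects the corresponding coordinates. With
   K = E^T Syy E + T^-1, which is positive definite, a Woodbury-type identity gives
   S - S (Syy^-1 + S)^-1 S = E K^-1 E^T. The right-hand side is the gain term of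
   the posterior covariance, so Pd - M Sigma^+ M^T is the Schur complement of the
   block D in the matrix of the linear matrix inequality. The two problems
   therefore have the same feasible set. *)
Require Import Defs.

Set Implicit Arguments.
Unset Strict Implicit.
Unset Printing Implicit Defensive.

Import Order.TTheory GRing.Theory Num.Theory.
Local Open Scope ring_scope.

(** * Definite and semidefinite matrices, congruences, Schur complement *)

Section SemidefiniteMatrices.
Context {R : realType}.

Lemma posdef_possemidef m (M : 'M[R]_m) : posdef M -> possemidef M.
Proof.
move=> [sM pM]; split=> // x.
have [->|/pM/ltW//] := eqVneq x 0.
by rewrite mulmx0 mxE.
Qed.

Lemma possemidefD m (M N : 'M[R]_m) :
  possemidef M -> possemidef N -> possemidef (M + N).
Proof.
move=> [sM pM] [sN pN]; split; first by rewrite linearD /= sM sN.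
by move=> x; rewrite mulmxDr mulmxDl mxE addr_ge0.
Qed.

Lemma posdefD m (M N : 'M[R]_m) :
  possemidef M -> posdef N -> posdef (M + N).
Proof.
move=> [sM pM] [sN pN]; split; first by rewrite linearD /= sM sN.
by move=> x x0; rewrite mulmxDr mulmxDl mxE ltr_wpDl ?pN.
Qed.

Lemma possemidef_congr m p (U : 'M[R]_(p, m)) (M : 'M[R]_m) :
  possemidef M -> possemidef (U *m M *m U^T).
Proof.
move=> [sM pM]; split; first by rewrite !trmx_mul trmxK sM mulmxA.
by move=> x; have := pM (U^T *m x); rewrite trmx_mul trmxK !mulmxA.
Qed.

(** A row [v] in the left kernel has [v *m M *m v^T = 0], so definiteness forces [v = 0]. *)
Lemma posdef_unitmx m (M : 'M[R]_m) : posdef M -> M \in unitmx.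
Proof.
move=> [sM pM]; rewrite -row_free_unit -kermx_eq0; apply/eqP/row_matrixP => i.
apply/eqP; rewrite row0; apply: contraT => v0.
have vM : row i (kermx M) *m M = 0 by rewrite -row_mul mulmx_ker row0.
have := pM (row i (kermx M))^T; rewrite trmxK vM mul0mx mxE ltxx.
by rewrite -(inj_eq trmx_inj) trmxK trmx0 => /(_ v0).
Qed.

Lemma posdef_inv m (M : 'M[R]_m) : posdef M -> posdef (invmx M).
Proof.
move=> pM; have uM := posdef_unitmx pM; have [sM posM] := pM.
split; first by rewrite trmx_inv sM.
(* The form of [invmx M] at [x] equals the form of [M] at [invmx M *m x]. *)
move=> x x0; have := posM (invmx M *m x).
rewrite trmx_mul trmx_inv sM -!mulmxA (mulKVmx uM); apply.
by apply: contraNneq x0 => Mx; rewrite -(mulKVmx uM x) Mx mulmx0.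
Qed.

Lemma quad_diag_mx m (d : 'rV[R]_m) (x : 'cV[R]_m) :
  (x^T *m diag_mx d *m x) 0 0 = \sum_i d 0 i * x i 0 ^+ 2.
Proof.
rewrite mul_mx_diag !mxE; apply: eq_bigr => i _.
by rewrite !mxE expr2 mulrAC mulrC.
Qed.

Lemma possemidef_diag_mx m (d : 'rV[R]_m) :
  (forall i, 0 <= d 0 i) -> possemidef (diag_mx d).
Proof.
move=> d0; split; first exact: tr_diag_mx.
move=> x; rewrite quad_diag_mx; apply: sumr_ge0 => i _.
by rewrite mulr_ge0 ?sqr_ge0.
Qed.

Lemma posdef_diag_mx m (d : 'rV[R]_m) :
  (forall i, 0 < d 0 i) -> posdef (diag_mx d).
Proof.
move=> d0; split; first exact: tr_diag_mx.
move=> x x0; rewrite quad_diag_mx.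
have [i xi] : exists i, x i 0 != 0.
  by have /matrix0Pn[i [j]] := x0; rewrite ord1; exists i.
rewrite (bigD1 i) //= ltr_pwDl //.
  by apply: mulr_gt0; rewrite ?d0 // exprn_even_gt0.
by apply: sumr_ge0 => j _; apply: mulr_ge0; rewrite ?sqr_ge0 ?ltW.
Qed.

(** Both directions are congruences. Compressing the block matrix by the row [[1, - B D^-1]] leaves
    the Schur complement; conversely, block elimination writes the block matrix as a congruence of
    the Schur complement plus a congruence of [D]. *)
Lemma schur_possemidef m p (Z : 'M[R]_m) (B : 'M[R]_(m, p)) (D : 'M[R]_p) :
  posdef D ->
  possemidef (block_mx Z B B^T D) <-> possemidef (Z - B *m invmx D *m B^T).
Proof.
move=> pD; have uD := posdef_unitmx pD; have [sD _] := pD.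
have sV : (invmx D)^T = invmx D by rewrite trmx_inv sD.
split=> [/(possemidef_congr (row_mx 1%:M (- (B *m invmx D))))|pZ].
  rewrite mul_row_block tr_row_mx mul_row_col !mul1mx !mulNmx mulmxKV //.
  by rewrite subrr mul0mx addr0 trmx1 mulmx1.
have -> : block_mx Z B B^T D =
    col_mx 1%:M 0 *m (Z - B *m invmx D *m B^T) *m (col_mx 1%:M 0)^T
    + col_mx (B *m invmx D) 1%:M *m D *m (col_mx (B *m invmx D) 1%:M)^T.
  rewrite !tr_col_mx !mul_col_mx !mul_mx_row -!block_mxEv add_block_mx.
  rewrite !trmx1 !trmx0 !mulmx1 !mul1mx !mul0mx !mulmx0 !add0r mulmxKV //.
  by rewrite trmx_mul sV (mulKVmx uD) mulmxA subrK.
apply: possemidefD; first exact: possemidef_congr.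
by apply: possemidef_congr; exact: posdef_possemidef.
Qed.

End SemidefiniteMatrices.

(** * Removal of the sensors of zero precision *)

Section SensorSelection.
Context {R : realType}.

(** The columns of [E] are the unit vectors indexed by [I], so the product pads the positive
    precisions with zeros; a nonnegative entry outside [I] is itself zero. *)
Lemma diag_mx_selection p (l : 'cV[R]_p) (I := [set i | 0 < l i 0])
    (e := fun a : 'I_#|I| => enum_val a) (E := colsub e 1%:M : 'M[R]_(p, #|I|)) :
  (forall i, 0 <= l i 0) ->
  diag_mx l^T = E *m diag_mx (rowsub e l)^T *m E^T.
Proof.
move=> l0; apply/matrixP => i j; rewrite mul_mx_diag !mxE.
have [iI|iI] := boolP (i \in I).
  rewrite (bigD1 (enum_rank_in iI i)) //= big1 => [|a ai].
    by rewrite !mxE /e enum_rankK_in // eqxx mul1r addr0 mulr_natr eq_sym.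
  rewrite !mxE; case: eqP => [ia|]; last by rewrite !mul0r.
  by case/eqP: ai; apply: enum_val_inj; rewrite enum_rankK_in.
(* For [i] outside [I], row [i] of [E] vanishes. *)
rewrite big1 => [|a _].
  move: iI; rewrite inE -leNgt => li.
  have -> : l i 0 = 0 by apply/eqP; rewrite eq_le li l0.
  by rewrite mul0rn.
rewrite !mxE; case: eqP => [ia|]; last by rewrite !mul0r.
by rewrite ia /e enum_valP in iI.
Qed.

(** Everything follows from [T E^T Y E = T K - 1], which is the definition of [K] multiplied by [T].
    No inverse of [S] may appear, since [S] is singular as soon as one sensor is removed. *)
Lemma woodbury_selection p r (Y : 'M[R]_p) (E : 'M[R]_(p, r)) (T : 'M[R]_r)
    (S := E *m T *m E^T) (K := E^T *m Y *m E + invmx T) :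
  Y \in unitmx -> T \in unitmx -> K \in unitmx -> invmx Y + S \in unitmx ->
  S - S *m invmx (invmx Y + S) *m S = E *m invmx K *m E^T.
Proof.
move=> uY uT uK uD; set D := invmx Y + S.
have TG : T *m (E^T *m Y *m E) = T *m K - 1%:M.
  by rewrite mulmxDr mulmxV // addrK.
(* This exhibits [D^-1 S] as [Y E K^-1 E^T]; the product expands to
   [E K^-1 E^T + E (T K - 1) K^-1 E^T]. *)
have DS : D *m (Y *m E *m invmx K *m E^T) = S.
  rewrite mulmxDl !mulmxA mulVmx // mul1mx.
  have -> : S *m Y *m E = E *m (T *m (E^T *m Y *m E)) by rewrite !mulmxA.
  rewrite TG mulmxBr mulmx1 !mulmxBl mulmxA mulmxK //.
  by rewrite addrC subrK.
have -> : S *m invmx D *m S = E *m (T *m (E^T *m Y *m E)) *m invmx K *m E^T.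
  by rewrite -{2}DS -!mulmxA (mulKmx uD) /S !mulmxA.
by rewrite TG mulmxBr mulmx1 !mulmxBl mulmxA mulmxK // opprB addrC subrK.
Qed.

(** Replaces the index set depending on [l] by one formula in full-size matrices, valid for every
    pattern of zero precisions, including the empty selection. *)
Lemma posterior_gain m p (Sxx : 'M[R]_m) (Sxy : 'M[R]_(m, p)) (Syy : 'M[R]_p)
    (l : 'cV[R]_p) (S := diag_mx l^T) :
  posdef Syy -> (forall i, 0 <= l i 0) ->
  posterior Sxx Sxy Syy l =
    Sxx - Sxy *m (S - S *m invmx (invmx Syy + S) *m S) *m Sxy^T.
Proof.
move=> pY l0; rewrite /posterior.
set I := [set i | 0 < l i 0]; set e := fun a : 'I_#|I| => enum_val a.
set E : 'M[R]_(p, #|I|) := colsub e 1%:M.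
set T := diag_mx (rowsub e l)^T.
have pT : posdef T.
  apply: posdef_diag_mx => a; rewrite !mxE.
  by have := enum_valP a; rewrite inE.
have eC : colsub e Sxy = Sxy *m E by rewrite mulmx_colsub mulmx1.
have eY : mxsub e e Syy = E^T *m Syy *m E.
  have -> : E^T = rowsub e 1%:M by rewrite /E trmx_mxsub trmx1.
  by rewrite mulmx_colsub mulmx1 mul_rowsub_mx mul1mx mxsubcr.
have pK : posdef (E^T *m Syy *m E + invmx T).
  apply: posdefD; last exact: posdef_inv.
  rewrite -{2}(trmxK E); exact/possemidef_congr/posdef_possemidef.
(* [S] is only semidefinite here; definiteness comes from [invmx Syy]. *)
have pD : posdef (invmx Syy + S).
  rewrite addrC; apply: posdefD; last exact: posdef_inv.
  by apply: possemidef_diag_mx => i; rewrite mxE.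
have SE : S = E *m T *m E^T by exact: diag_mx_selection.
rewrite eC eY SE woodbury_selection -?SE ?posdef_unitmx //.
by rewrite trmx_mul !mulmxA.
Qed.

Lemma lmi_feasibleP n m p (Sxx : 'M[R]_m) (Sxy : 'M[R]_(m, p)) (Syy : 'M[R]_p)
    (M : 'M[R]_(n, m)) (P : 'M[R]_n) (l : 'cV[R]_p) :
  posdef Syy ->
  bound_feasible Sxx Sxy Syy M P l <-> lmi_feasible Sxx Sxy Syy M P l.
Proof.
move=> pY.
(* Nonnegativity occurs in both feasible sets, so only the matrix constraints need comparing, and
   only for [l >= 0]. *)
suff H : (forall i, 0 <= l i 0) ->
    (loewner_le (M *m posterior Sxx Sxy Syy l *m M^T) P <->
     possemidef (lmi_matrix Sxx Sxy Syy M P l)).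
  by split=> [[l0 /(H l0)]|[/[swap] l0 /(H l0)]].
move=> l0; rewrite /lmi_matrix /loewner_le posterior_gain //.
set S := diag_mx l^T.
have pD : posdef (invmx Syy + S).
  rewrite addrC; apply: posdefD; last exact: posdef_inv.
  by apply: possemidef_diag_mx => i; rewrite mxE.
rewrite schur_possemidef //; set V := invmx _.
suff -> : P - M *m (Sxx - Sxy *m (S - S *m V *m S) *m Sxy^T) *m M^T =
    P + (- (M *m Sxx *m M^T) + M *m Sxy *m S *m Sxy^T *m M^T)
    - M *m Sxy *m S *m V *m (M *m Sxy *m S)^T by [].
rewrite !trmx_mul (tr_diag_mx l^T) -/S.
rewrite !(mulmxBr, mulmxBl) !mulmxA !opprB -[RHS]addrA; congr (P + _).
by rewrite [LHS]addrC addrA.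
Qed.

End SensorSelection.

(** * Linear cost and affine matrix constraint *)

Section SemidefiniteProgram.
Context {R : realType}.

Lemma norm1_linear m (l : 'cV[R]_m) :
  (forall i, 0 <= l i 0) -> norm1 l = ((ones m)^T *m l) 0 0.
Proof.
move=> l0; rewrite mxE; apply: eq_bigr => i _.
by rewrite !mxE mul1r ger0_norm.
Qed.

(** With [W] the column of blocks [M Sxy] and [1], the part depending on [l] is [W S W^T]. Splitting
    the diagonal matrix [S] into its entries gives the rank-one-selected coefficients
    [W (delta_mx i i) W^T]. *)
Lemma lmi_matrix_affine n m p (Sxx : 'M[R]_m) (Sxy : 'M[R]_(m, p))
    (Syy : 'M[R]_p) (M : 'M[R]_(n, m)) (P : 'M[R]_n) :
  Sxx^T = Sxx -> Syy^T = Syy -> P^T = P ->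
  affine_symmetric (lmi_matrix Sxx Sxy Syy M P).
Proof.
move=> sX sY sP; pose W := col_mx (M *m Sxy) 1%:M.
exists (block_mx (P - M *m Sxx *m M^T) 0 0 (invmx Syy)).
exists (fun i => W *m delta_mx i i *m W^T); split.
- rewrite tr_block_mx !trmx0 trmx_inv sY linearB /= !trmx_mul trmxK sX sP.
  by rewrite mulmxA.
- by move=> i; rewrite !trmx_mul trmxK trmx_delta mulmxA.
move=> l; have -> : \sum_i l i 0 *: (W *m delta_mx i i *m W^T) =
    W *m diag_mx l^T *m W^T.
  rewrite diag_mx_sum_delta mulmx_sumr mulmx_suml; apply: eq_bigr => i _.
  by rewrite mxE -scalemxAr -scalemxAl.
rewrite /lmi_matrix /W tr_col_mx mul_col_mx mul_col_row trmx1 !mulmx1 !mul1mx.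
rewrite add_block_mx !add0r !trmx_mul tr_diag_mx.
by congr block_mx; rewrite ?mulmxA ?addrA.
Qed.

Lemma enkf_xx_sym m N (X : 'M[R]_(m, N)) : (enkf_xx X)^T = enkf_xx X.
Proof.
rewrite /enkf_xx linearZ /= !trmx_mul trmxK linearB /= linearZ /=.
by rewrite trmx_mul trmxK trmx1 !mulmxA.
Qed.

Lemma ukf_xx_sym na m (X : 'M[R]_(m, 1 + (na + na))) :
  (ukf_xx X)^T = ukf_xx X.
Proof. by rewrite /ukf_xx !trmx_mul !trmxK !mulmxA. Qed.

End SemidefiniteProgram.

Theorem theorem1 (R : realType) (n ny nw q : nat)
    (hn : (1 <= n)%N) (hny : (1 <= ny)%N) (hq : (1 <= q)%N)
    (f : int -> 'cV[R]_n -> 'cV[R]_nw -> 'cV[R]_n)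
    (h : int -> 'cV[R]_n -> 'cV[R]_ny)
    (Q : int -> 'M[R]_nw) (hQ : forall j, possemidef (Q j))
    (k : int)
    (Pd : 'M[R]_n) (hPd : posdef Pd)
    (Sxx : 'M[R]_(stacked q n)) (Sxy : 'M[R]_(stacked q n, stacked q ny))
    (Syy : 'M[R]_(stacked q ny))
    (hprior : enkf_prior f h k Sxx Sxy Syy \/ ukf_prior f h Q k Sxx Sxy Syy)
    (hSyy : posdef Syy) :
  (forall l : 'cV[R]_(stacked q ny),
     minimizer (bound_feasible Sxx Sxy Syy (last_block n q) Pd) (@norm1 R _) l <->
     minimizer (lmi_feasible Sxx Sxy Syy (last_block n q) Pd) (@norm1 R _) l)
  /\ semidefinite_program (@norm1 R _)
       (lmi_matrix Sxx Sxy Syy (last_block n q) Pd).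
Proof.
have [sY _] := hSyy; have [sP _] := hPd.
(* Both filter formulas yield a symmetric [Sxx], which makes the constant term of the matrix
   inequality symmetric. *)
have sX : Sxx^T = Sxx.
  case: hprior => [[N [Xp [Wp [_ -> _ _]]]]|[mu [Sp [S [_ _ -> _ _]]]]].
    exact: enkf_xx_sym.
  exact: ukf_xx_sym.
have feasP l := lmi_feasibleP Sxx Sxy (last_block n q) Pd l hSyy.
split; first by move=> l; split=> [[/feasP ? opt]|[/feasP ? opt]];
  split=> // y /feasP; exact: opt.
split; last exact: lmi_matrix_affine.
by exists (ones _) => l; exact: norm1_linear.
Qed.
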